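(* The full Grassmannian $G(X)$, with distances given by the Grassmann angle, i.e. with $d(V,W)=\Theta_{V,W}$ for $V,W\in G(X)$, is an asymmetric metric space.
   Context: $X$ is an $n$-dimensional vector space over $\mathbb{R}$ (real case) or $\mathbb{C}$ (complex case) with an inner product $\langle\cdot,\cdot\rangle$ (Hermitian in the complex case, conjugate-linear in the left entry). Subspaces and dimensions are over the same field. $G(X)$ is the set of all subspaces of $X$ (of all dimensions $0,\dots,n$). An asymmetric metric on a non-empty set $M$ is a function $d:M\times M\to[0,\infty)$ such that for all $x,y,z\in M$: (i) $d(x,y)=d(y,x)=0\Leftrightarrow x=y$; (ii) $d(x,z)\le d(x,y)+d(y,z)$. Principal angles: for nonzero subspaces $V,W\subset X$, with $p=\dim V$, $q=\dim W$, $m=\min\{p,q\}$, there are orthonormal bases $(e_1,\dots,e_p)$ of $V$ and $(f_1,\dots,f_q)$ of $W$ and uniquely determined numbers $0\le\theta_1\le\dots\le\theta_m\le\frac{\pi}{2}$ (the principal angles) such that $\langle e_i,f_j\rangle=\delta_{ij}\cos\theta_i$ (equal to $0$ whenever $i\neq j$). Grassmann angle: for nonzero subspaces $V,W\subset X$ with principal angles $\theta_1,\dots,\theta_m$, the Grassmann angle $\Theta_{V,W}\in[0,\frac{\pi}{2}]$ of $V$ with $W$ is $\Theta_{V,W}=\arccos(\cos\theta_1\cdots\cos\theta_m)$ if $\dim V\le\dim W$, and $\Theta_{V,W}=\frac{\pi}{2}$ if $\dim V>\dim W$. Also $\Theta_{\{0\},\{0\}}=\Theta_{\{0\},V}=0$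 and $\Theta_{V,\{0\}}=\frac{\pi}{2}$ for $V\ne\{0\}$. *)

(* Defs.v *)
From HB Require Import structures.
From mathcomp Require Import all_boot all_order all_algebra.
From mathcomp Require Import sesquilinear.
From mathcomp Require Import mathcomp_extra boolp classical_sets reals trigo.
From mathcomp Require Import complex.

Set Implicit Arguments.
Unset Strict Implicit.
Unset Printing Implicit Defensive.

Import Order.TTheory GRing.Theory Num.Theory.

Local Open Scope ring_scope.

Record asymmetric_metric (R : realType) (M : Type) (d : M -> M -> R) : Prop :=
  AsymmetricMetric {
    asym_metric_inhabited : inhabited M;
    asym_metric_ge0 : forall x y, 0 <= d x y;
    asym_metric_eq0 : forall x y, (d x y = 0 /\ d y x = 0) <-> x = y;
    asym_metric_triangle : forall x y z, d x z <= d x y + d y z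
  }.

(* [K] is the scalar field, either [R] or [R[i]], [toK] the inclusion of [R]
   into [K], and [conj] the conjugation of [K] (the identity when [K] is [R]).
   The library's [form : {dot X for conj}] is linear on the left and
   conjugate-linear on the right; the inner product <u, v> that is
   conjugate-linear in its left entry is therefore [form v u]. *)
Section GrassmannAngle.
Variables (R : realType) (K : numFieldType).
Variables (toK : {rmorphism R -> K}) (conj : {rmorphism K -> K}).
Variables (X : vectType K) (form : {dot X for conj}).

Definition inner (u v : X) : K := form v u.

Definition is_principal_angles (V W : {vspace X}) (t : seq R) : Prop :=
  [/\ size t = minn (\dim V) (\dim W),
      sorted <=%R t,
      {in t, forall x, 0 <= x <= pi / 2} &
      exists (e : (\dim V).-tuple X) (f : (\dim W).-tuple X),
        [/\ basis_of V e /\ orthonormal form e,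
            basis_of W f /\ orthonormal form f &
            forall (i : 'I_(\dim V)) (j : 'I_(\dim W)),
              inner (tnth e i) (tnth f j) =
                if i == j :> nat then toK (cos t`_i) else 0]].

(* Principal angles exist and are unique for all [V] and [W], so the default
   value [[::]] is never used. *)
Definition principal_angles (V W : {vspace X}) : seq R :=
  xget [::] [set t | is_principal_angles V W t]%classic.

Definition grassmann_angle (V W : {vspace X}) : R :=
  if V == 0%VS then 0
  else if W == 0%VS then pi / 2
  else if (\dim V <= \dim W)%N then
    acos (\prod_(x <- principal_angles V W) cos x)
  else pi / 2.

End GrassmannAngle.

(* Main.v *)
Require Import Defs.
From HB Require Import structures.
From mathcomp Require Import all_boot all_order all_algebra.
From mathcomp Require Import sesquilinear.
From mathcomp Require Import reals trigo.
From mathcomp Require Import complex.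
From mathcomp Require Import perm spectral classical_sets ring lra.

Set Implicit Arguments.
Unset Strict Implicit.
Unset Printing Implicit Defensive.

Import Order.TTheory GRing.Theory Num.Theory.

Local Open Scope ring_scope.
Local Open Scope sesquilinear_scope.

(** The cosine of the Grassmann angle of V with W, when dim V <= dim W, is the
norm of the orthogonal projection to the exterior power of W of a unit
decomposable p-vector of V, where p = dim V. The exterior power is replaced
here by Pluecker coordinates: a p x n matrix A over the complex numbers (the
coordinates of p vectors in an orthonormal basis of X) is sent to the vector
[plucker A] of its p x p minors, normalised so that the Cauchy-Binet formula
reads <plucker A, plucker B> = det (A B^* ).

Triangle inequality. If one of the two angles on the right is pi/2, the
inequality holds since no angle exceeds pi/2. Otherwise either U = 0, or
dim U <= dim V <= dim W with none of them 0. Let e and f be principal bases of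
U and V, a the product of their cosines, x the Pluecker vector of e, y that of
the first p = dim U vectors of f (a unit vector with <x, y> = a), and z the
projection of y to the p-vectors of W. With s = |z|, [dot_triangle] and
[acos_triangle] give the spherical triangle inequality
acos g <= acos a + acos s, where g, the cosine of the angle of U with W,
satisfies |<x, z>| <= g s by Cauchy-Schwarz ([det_CauchySchwarz]). Finally s is
at least the cosine d of the angle of V with W, because replacing V by a
subspace of dimension p can only increase the cosine: in principal bases s^2
is the determinant of a compression of the diagonal matrix of squared cosines,
which Cauchy-Binet bounds below ([prod_le_det_compression]).

Separation. The angle of V with W is 0 exactly when V is contained in W
([angle_eq0]): a product of cosines equal to 1 forces every principal vector
of V to coincide with its partner in W. Two inclusions give equality.

Both parts need principal bases to exist. They are built two vectors at a time
([principal_pair]) from an eigenvector of the compression to V of the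
projection to W; the eigenvalue is found over the complex numbers and is real.
Real and complex spaces are treated together: the scalar field K comes with an
embedding [kap] into the complex numbers compatible with conjugation. *)

(** * Determinants of products and minors *)

Section CauchyBinet.
Variables (F : comNzRingType) (p n : nat).
Implicit Types (A B : 'M[F]_(p, n)) (f : {ffun 'I_p -> 'I_n}).

(** Expanding only the entries of A B^T by multilinearity in the rows of A
leaves, for each choice f of one column per row, a determinant in B alone. *)
Lemma det_mul_tr_sum_prod A B :
  \det (A *m B^T) = \sum_(f : {ffun 'I_p -> 'I_n})
    (\prod_i A i (f i)) * \det (colsub f B).
Proof.
pose G (s : 'S_p) i k := A i k * B (s i) k.
transitivity (\sum_(f : {ffun 'I_p -> 'I_n}) \sum_(s : 'S_p)
  (-1) ^+ s * \prod_i G s i (f i)).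
  rewrite exchange_big; apply: eq_bigr => /= s _; rewrite -big_distrr /=.
  congr (_ * _); rewrite -(bigA_distr_bigA (G s)) /=.
  by apply: eq_bigr => i _; rewrite mxE; apply: eq_bigr => k _; rewrite mxE.
apply: eq_bigr => f _; rewrite -det_tr /determinant big_distrr /=.
apply: eq_bigr => s _; rewrite mulrCA big_split //=; congr (_ * (_ * _)).
by apply: eq_bigr => i _; rewrite !mxE.
Qed.

Lemma det_colsub_perm A f (s : 'S_p) :
  \det (colsub (fun i => f (s i)) A) = (-1) ^+ s * \det (colsub f A).
Proof.
suff -> : colsub (fun i => f (s i)) A = col_perm s (colsub f A).
  by rewrite col_permE det_mulmx det_perm mulrC odd_permV.
by apply/matrixP=> i j; rewrite !mxE.
Qed.

(** Summing over all maps f, instead of over the p-subsets of columns, counts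
each minor p! times and adds zero terms, but spares an enumeration of
subsets. The proof antisymmetrises [det_mul_tr_sum_prod] over the
permutations of the rows. *)
Lemma cauchy_binet A B :
  p`!%:R * \det (A *m B^T) = \sum_(f : {ffun 'I_p -> 'I_n})
    \det (colsub f A) * \det (colsub f B).
Proof.
transitivity (\sum_(s : 'S_p) \det (A *m B^T)).
  by rewrite sumr_const card_Sn mulr_natl.
transitivity (\sum_(s : 'S_p) \sum_(f : {ffun 'I_p -> 'I_n})
  (-1) ^+ s * (\prod_i A i (f (s i))) * \det (colsub f B)).
  apply: eq_bigr => s _; rewrite det_mul_tr_sum_prod.
  rewrite (reindex (fun f : {ffun 'I_p -> 'I_n} => [ffun i => f (s i)])) /=;
    last first.
    exists (fun f : {ffun 'I_p -> 'I_n} => [ffun i => f ((s^-1)%g i)]) => f _;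
      apply/ffunP=> i.
      by rewrite !ffunE permKV.
    by rewrite !ffunE permK.
  apply: eq_bigr => f _.
  under eq_bigr do rewrite ffunE.
  have -> : colsub [ffun i => f (s i)] B = colsub (fun i => f (s i)) B.
    by apply/matrixP=> i j; rewrite !mxE ffunE.
  by rewrite det_colsub_perm mulrCA mulrA.
rewrite exchange_big; apply: eq_bigr => f _; rewrite -big_distrl /=.
congr (_ * _); rewrite /determinant; apply: eq_bigr => s _; congr (_ * _).
by apply: eq_bigr => i _; rewrite mxE.
Qed.

End CauchyBinet.

Section Plucker.
Variable C : numClosedFieldType.

(** The factor 1 / sqrt p! compensates the p! orderings of each set of
columns. *)
Definition plucker p n (A : 'M[C]_(p, n)) : 'rV[C]_#|{: {ffun 'I_p -> 'I_n}}| :=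
  \row_k ((sqrtC p`!%:R)^-1 *
          \det (colsub (enum_val k : {ffun 'I_p -> 'I_n}) A)).

Lemma dotmx_plucker p n (A B : 'M[C]_(p, n)) :
  dotmx (plucker A) (plucker B) = \det (A *m B^t*).
Proof.
have fact0 : p`!%:R != 0 :> C by rewrite pnatr_eq0 -lt0n fact_gt0.
apply: (mulfI fact0); rewrite -map_trmx cauchy_binet.
rewrite dotmxE mxE mulr_sumr.
rewrite [RHS](reindex (@enum_val _ (mem {: {ffun 'I_p -> 'I_n}}))) /=;
  last first.
  exact/onW_bij/enum_val_bij.
apply: eq_bigr => k _; rewrite !mxE -map_mxsub det_map_mx /=.
rewrite rmorphM /= mulrACA -normCK normfV exprVn ger0_norm ?sqrtC_ge0 ?ler0n //.
by rewrite sqrtCK mulVKf.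
Qed.

Lemma det_mulmx_conj_ge0 p n (A : 'M[C]_(p, n)) : 0 <= \det (A *m A^t*).
Proof. by rewrite -dotmx_plucker dnorm_ge0. Qed.

Lemma det_CauchySchwarz p n (A B : 'M[C]_(p, n)) :
  `|\det (A *m B^t*)| ^+ 2 <= \det (A *m A^t*) * \det (B *m B^t*).
Proof. by rewrite -!dotmx_plucker; apply: CauchySchwarz. Qed.

(** By Cauchy-Binet the determinant is an average, with weights |det M_f|^2 /
p! of total mass det (M M^* ) = 1, of products of p distinct entries of d;
each is at least the product of all entries because these lie in [0, 1]. *)
Lemma prod_le_det_compression p q (M : 'M[C]_(p, q)) (d : 'I_q -> C) :
    M \is unitarymx -> (forall j, 0 <= d j <= 1) ->
  \prod_j d j <= \det (M *m diag_mx (\row_j d j) *m M^t*).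
Proof.
move=> /unitarymxP MM d01.
have fact0 : 0 < p`!%:R :> C by rewrite ltr0n fact_gt0.
rewrite -(ler_pM2l fact0) -[M^t*]map_trmx cauchy_binet.
have <- : \sum_(f : {ffun 'I_p -> 'I_q}) `|\det (colsub f M)| ^+ 2 = p`!%:R.
  rewrite -[RHS]mulr1 -[X in _ * X](det1 C p) -MM -map_trmx cauchy_binet.
  by apply: eq_bigr => f _; rewrite -map_mxsub det_map_mx -normCK.
rewrite mulr_suml; apply: ler_sum => f _.
have -> : colsub f (M *m diag_mx (\row_j d j)) =
          colsub f M *m diag_mx (\row_i d (f i)).
  by apply/matrixP=> i j; rewrite !mul_mx_diag !mxE.
rewrite det_mulmx det_diag -map_mxsub det_map_mx [leRHS]mulrAC -normCK.
case: (boolP (injectiveb f)) =>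
  [/injectiveP f_inj | /injectivePn[i [j ij fij]]].
  apply: ler_wpM2l; first by rewrite exprn_ge0.
  under [leRHS]eq_bigr do rewrite mxE.
  rewrite -(big_imset (fun j => d j) (h := f) (A := predT)) /=; last first.
    by move=> ? ? _ _; apply: f_inj.
  rewrite [leLHS](bigID (fun j => j \in [set f x | x in predT])) /=.
  apply: ler_piMr; first by apply: prodr_ge0 => k _; case/andP: (d01 k).
  apply: prodr_ile1 => k _; exact: d01.
rewrite -det_tr (determinant_alternate ij) ?normr0 ?expr0n ?mul0r //=.
by move=> k; rewrite !mxE fij.
Qed.

End Plucker.

(** * The spherical triangle inequality *)

Section AngleTriangle.
Variable R : realType.

Lemma ler_acos (x y : R) : -1 <= x <= 1 -> -1 <= y <= 1 ->
  (acos x <= acos y) = (y <= x).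
Proof.
move=> x1 y1; rewrite !leNgt -ltr_cos ?acosK ?in_itv //=.
  by rewrite acos_ge0 ?acos_lepi.
by rewrite acos_ge0 ?acos_lepi.
Qed.

Lemma acos_lepihalf (x : R) : 0 <= x <= 1 -> acos x <= pi / 2.
Proof. by move=> x01; rewrite -acos0 ler_acos; lra. Qed.

(** The hypothesis says cos (acos a + acos s) <= g, for the sine of acos t is
sqrt (1 - t^2). *)
Lemma acos_triangle (a s g : R) :
    0 <= a <= 1 -> 0 <= s <= 1 -> 0 <= g <= 1 ->
    a * s <= g \/ (a * s - g) ^+ 2 <= (1 - a ^+ 2) * (1 - s ^+ 2) ->
  acos g <= acos a + acos s.
Proof.
move=> a01 s01 g01 asg.
have N1 (x : R) : 0 <= x <= 1 -> -1 <= x <= 1 by lra.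
have cos_le : cos (acos a + acos s) <= g.
  rewrite cosD !acosK ?in_itv /= ?N1 // !sin_acos ?N1 //.
  rewrite -sqrtrM; last by rewrite subr_ge0 expr_le1; case/andP: a01.
  rewrite lerBlDr -lerBlDl; case: asg => asg.
    by apply: le_trans (sqrtr_ge0 _); rewrite subr_le0.
  by apply: le_trans (ler_norm _) _; rewrite -sqrtr_sqr ler_wsqrtr.
have := acos_lepihalf a01; have := acos_lepihalf s01.
have := acos_ge0 (N1 _ a01); have := acos_ge0 (N1 _ s01).
move=> as0 aa0 as2 aa2.
rewrite leNgt -ltr_cos ?acosK ?in_itv /= ?N1 // -?leNgt //.
  by rewrite addr_ge0 //=; lra.
by rewrite acos_ge0 ?acos_lepi ?N1.
Qed.

(** Cauchy-Schwarz for the components of x and z orthogonal to y. The vector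
z is left unnormalised, as the projection of y to a subspace: this is why <y,
z> = <z, z>, and why the bound on <x, z> carries a factor s. *)
Lemma dot_triangle (U : vectType R[i]) (form : {dot U for @Num.conj R[i]})
    (x y z : U) (a s g : R) :
    form x x = 1 -> form y y = 1 -> form x y = a%:C%C ->
    form y z = (s ^+ 2)%:C%C -> form z z = (s ^+ 2)%:C%C ->
    `|form x z| <= (g * s)%:C%C -> 0 <= s -> 0 <= g ->
  a * s <= g \/ (a * s - g) ^+ 2 <= (1 - a ^+ 2) * (1 - s ^+ 2).
Proof.
move=> xx yy xy yz zz xz s0 g0.
have [|gas] := leP (a * s) g; [by left | right].
have s_gt0 : 0 < s.
  rewrite lt_def s0 andbT; apply: contraTneq gas => ->.
  by rewrite mulr0 -leNgt.
have yx : form y x = a%:C%C.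
  by rewrite hermC /= expr0 mul1r xy; apply: conjc_real.
have zy : form z y = (s ^+ 2)%:C%C.
  by rewrite hermC /= expr0 mul1r yz; apply: conjc_real.
have conjR (r : R) : (r%:C%C)^* = r%:C%C by apply: conjc_real.
pose u := x - a%:C%C *: y; pose v := z - (s ^+ 2)%:C%C *: y.
have uv : form u v = form x z - (a * s ^+ 2)%:C%C.
  rewrite linearBl !linearBr /= !linearZl_LR !linearZr_LR /= xy yy yz !conjR.
  by ring.
have uu : form u u = (1 - a ^+ 2)%:C%C.
  rewrite linearBl !linearBr /= !linearZl_LR !linearZr_LR /= xx xy yx yy !conjR.
  by ring.
have vv : form v v = (s ^+ 2 * (1 - s ^+ 2))%:C%C.
  rewrite linearBl !linearBr /= !linearZl_LR !linearZr_LR /= zz zy yz yy !conjR.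
  by ring.
(* Nonnegative because g < a s, hence comparable with Cauchy-Schwarz after
   squaring. *)
have lower : (s * (a * s - g))%:C%C <= `|form u v|.
  rewrite uv distrC; apply: le_trans (lerB_dist _ _).
  rewrite ger0_norm; last by rewrite ler0c; nra.
  rewrite lerBrDr; apply: le_trans (lerD (lexx _) xz) _.
  by rewrite -rmorphD lecR; lra.
have := CauchySchwarz form u v; rewrite uu vv => -[+ _].
have sas0 : 0 <= s * (a * s - g) by rewrite mulr_ge0 // subr_ge0 ltW.
rewrite -[0 <= _]ler0c in sas0.
move/(le_trans (lerXn2r 2 _ _ lower)); rewrite !nnegrE normr_ge0 sas0.
rewrite -rmorphXn -rmorphM lecR => /(_ isT isT).
by rewrite exprMn [leRHS]mulrCA ler_pM2l // exprn_gt0.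
Qed.
End AngleTriangle.

(** * Inner products and orthonormal bases *)

Lemma ge0_real_complex (R : realType) (z : R[i]) :
  0 <= z -> exists2 r : R, 0 <= r & z = r%:C%C.
Proof.
move=> z0; exists (complex.Re z); last by rewrite RRe_real ?ger0_real.
by rewrite -ler0c RRe_real ?ger0_real.
Qed.

Section InnerProductSpace.
Variables (R : realType) (K : numFieldType).
Variables (toK : {rmorphism R -> K}) (conj : {rmorphism K -> K}).
Variable kap : {rmorphism K -> R[i]}.
Hypothesis kap_toK : forall r, kap (toK r) = r%:C%C.
Hypothesis kap_conj : forall x, kap (conj x) = (kap x)^*.
Hypothesis kap_ge0 : forall x : K, 0 <= x -> 0 <= kap x.

Let kap_inj : injective kap := @fmorph_inj _ _ kap.

Lemma conj_toK r : conj (toK r) = toK r.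
Proof. by apply: kap_inj; rewrite kap_conj !kap_toK; apply: conjc_real. Qed.

Lemma toK_eq0 r : (toK r == 0) = (r == 0).
Proof. exact: fmorph_eq0. Qed.

Lemma ge0_toK (x : K) : 0 <= x -> exists2 r, 0 <= r & x = toK r.
Proof.
move=> /kap_ge0 /ge0_real_complex[r r0 kx]; exists r => //.
by apply: kap_inj; rewrite kap_toK.
Qed.

(** An eigenvalue exists over the complex numbers, where M M^* being positive
makes it real; a real eigenvalue descends to K since the rank of a matrix
does not change under field extension. *)
Lemma gram_mx_eigenvector p q (M : 'M[K]_(p, q)) : (0 < p)%N ->
  exists lam (a : 'rV[K]_p), a != 0 /\ a *m (M *m M^t conj) = toK lam *: a.
Proof.
move=> p_gt0; pose N := map_mx kap M.
have kapMM : map_mx kap (M *m M^t conj) = N *m N^t*.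
  rewrite map_mxM; congr (_ *m _).
  by apply/matrixP=> i j; rewrite !mxE kap_conj.
have [mu eig_mu] := eigenvalue_closed (N *m N^t*) p_gt0.
have /eigenvalueP [v vN v0] := eig_mu.
have vv : 0 < dotmx v v by rewrite dnorm_gt0.
have : 0 <= mu.
  rewrite -(pmulr_lge0 _ vv).
  have -> : mu * dotmx v v = dotmx (v *m N) (v *m N).
    by rewrite -linearZl_LR /= -vN !dotmxE trmx_mul map_mxM !mulmxA.
  exact: dnorm_ge0.
move=> /ge0_real_complex[lam _ mu_lam]; exists lam.
move: eig_mu; rewrite -kapMM mu_lam -kap_toK eigenvalue_map.
by case/eigenvalueP=> a aM a0; exists a.
Qed.

Variables (X : vectType K) (form : {dot X for conj}).
Implicit Types (u v w : X) (U V W : {vspace X}).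

Lemma form_conjC u v : form u v = conj (form v u).
Proof. by rewrite hermC /= expr0 mul1r. Qed.

Lemma form_sym0 u v : form u v = 0 -> form v u = 0.
Proof. by move=> uv; rewrite form_conjC uv rmorph0. Qed.

Lemma form_eq0 u : (form u u == 0) = (u == 0).
Proof.
have [->|u0] := eqVneq u 0; first by rewrite linear0r eqxx.
by rewrite gt_eqF // neq0_dnorm_gt0.
Qed.

Lemma form_toK u : exists2 r, 0 <= r & form u u = toK r.
Proof.
apply: ge0_toK; have [->|u0] := eqVneq u 0; first by rewrite linear0r.
by rewrite ltW // neq0_dnorm_gt0.
Qed.

Lemma formBB u v : form (u - v) (u - v) =
  form u u - form u v - form v u + form v v.
Proof. by rewrite linearBl !linearBr; ring. Qed.

Lemma normalize u : u != 0 -> exists2 a, a != 0 & form (a *: u) (a *: u) = 1.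
Proof.
move=> u0; have [r r0 uu] := form_toK u.
have r_neq0 : r != 0 by rewrite -toK_eq0 -uu form_eq0.
exists (toK (Num.sqrt r)^-1).
  by rewrite toK_eq0 invr_eq0 sqrtr_eq0 -ltNge lt_def r_neq0.
rewrite linearZl_LR linearZr_LR /= uu conj_toK mulrA -!rmorphM -expr2 exprVn.
by rewrite sqr_sqrtr // mulVf // rmorph1.
Qed.

Definition onb V n (e : 'I_n -> X) : Prop :=
  [/\ \dim V = n, forall i, e i \in V &
      forall i j, form (e i) (e j) = (i == j)%:R].

Lemma form_sum_on n (e : 'I_n -> X) (a : 'I_n -> K) i :
  (forall i j, form (e i) (e j) = (i == j)%:R) ->
  form (\sum_i a i *: e i) (e i) = a i.
Proof.
move=> e_on; rewrite linear_sumlz (bigD1 i) //= big1 => [|j ji].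
  by rewrite linearZl_LR /= e_on eqxx mulr1 addr0.
by rewrite linearZl_LR /= e_on (negbTE ji) mulr0.
Qed.

Lemma orthonormal_family_free n (e : 'I_n -> X) :
  (forall i j, form (e i) (e j) = (i == j)%:R) -> free (mktuple e).
Proof.
move=> e_on; apply/freeP => a sum0 i; rewrite -(form_sum_on a i e_on).
under eq_bigr do rewrite -(nth_mktuple e 0).
by rewrite sum0 linear0l.
Qed.

Lemma onb_basis V n (e : 'I_n -> X) : onb V e -> basis_of V (mktuple e).
Proof.
move=> [dimV eV e_on]; rewrite basisEfree orthonormal_family_free //.
rewrite size_tuple dimV leqnn andbT.
by apply/span_subvP=> _ /mapP[i _ ->].
Qed.

Lemma onb_expand V n (e : 'I_n -> X) u : onb V e -> u \in V ->
  u = \sum_i form u (e i) *: e i.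
Proof.
move=> e_onb uV; have [_ _ e_on] := e_onb.
have := coord_basis (onb_basis e_onb) uV.
under eq_bigr do rewrite nth_mktuple.
move=> u_sum; rewrite {1}u_sum; apply: eq_bigr => i _; congr (_ *: _).
by rewrite [in RHS]u_sum form_sum_on.
Qed.

Lemma onb_form V n (e : 'I_n -> X) u v : onb V e -> u \in V ->
  form u v = \sum_i form u (e i) * form (e i) v.
Proof.
move=> e_onb uV; rewrite {1}(onb_expand e_onb uV) linear_sumlz.
by apply: eq_bigr => i _; rewrite linearZl_LR.
Qed.

Lemma dim_orthov_line V u : u \in V -> form u u = 1 ->
  \dim V = (\dim (V :&: orthov form <[u]>)).+1.
Proof.
move=> uV uu; rewrite -(@eq_dim_orthov1 _ _ _ _ form u); last first.
  by apply/mem_orthovPn; exists u => //=; rewrite uu oner_eq0.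
rewrite prednK // lt0n dimv_eq0; apply/eqP=> V0.
by move: uV; rewrite V0 memv0 -form_eq0 uu oner_eq0.
Qed.

(** Stated for families indexed by ordinals, with the new vector in position 0,
which is the shape of the inductions on the dimension. *)
Lemma onb_cons V n (u : X) (e : 'I_n -> X) :
    u \in V -> form u u = 1 -> onb (V :&: orthov form <[u]>) e ->
  onb V (fun i : 'I_n.+1 => if unlift ord0 i is Some j then e j else u).
Proof.
move=> uV uu [dimVu eV e_on].
have e_u i : form (e i) u = 0.
  by have := eV i; rewrite memv_cap mem_orthov1 => /andP[_ /eqP].
split; first by rewrite (dim_orthov_line uV uu) dimVu.
- move=> i; case: unliftP => [j|] _ //.
  by have := eV j; rewrite memv_cap => /andP[].
- move=> i j; case: unliftP => [i'|] ->; case: unliftP => [j'|] ->.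
  + by rewrite e_on (inj_eq lift_inj).
  + by rewrite e_u lift_eqF.
  + by rewrite form_sym0 // eq_liftF.
  + by rewrite uu eqxx.
Qed.

Lemma unit_vector V : (0 < \dim V)%N -> exists2 u, u \in V & form u u = 1.
Proof.
move=> dimV; have : vpick V != 0 by rewrite vpick0 -dimv_eq0 -lt0n.
move=> /normalize[a _ aa]; exists (a *: vpick V) => //.
by rewrite memvZ ?memv_pick.
Qed.

Lemma onb_exists V : exists e : 'I_(\dim V) -> X, onb V e.
Proof.
move: {-2}(\dim V) (erefl (\dim V)) => n; elim: n V => [|n IHn] V dimV.
  by exists (fun => 0); split=> // -[].
have [|u uV uu] := @unit_vector V; first by rewrite -dimV.
have [|e e_onb] := IHn (V :&: orthov form <[u]>)%VS.
  by apply: succn_inj; rewrite -dim_orthov_line.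
by eexists; apply: onb_cons uV uu e_onb.
Qed.

Lemma onb_form_r V n (e : 'I_n -> X) u v : onb V e -> v \in V ->
  form u v = \sum_i form u (e i) * form (e i) v.
Proof.
move=> e_onb vV; rewrite form_conjC (onb_form _ e_onb vV) rmorph_sum.
by apply: eq_bigr => i _; rewrite rmorphM -!form_conjC mulrC.
Qed.

(** * Principal bases *)

(** The m conditions are a homogeneous linear system in dim W > m unknowns. *)
Lemma unit_vector_orthogonal_to W m (g : 'I_m -> X) : (m < \dim W)%N ->
  exists w, [/\ w \in W, form w w = 1 & forall i, form w (g i) = 0].
Proof.
move=> ltm; have [f [_ fW f_on]] := onb_exists W.
pose M := \matrix_(j, i) form (f j) (g i).
have : kermx M != 0.
  rewrite -mxrank_eq0 mxrank_ker -lt0n subn_gt0.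
  by apply: leq_ltn_trans ltm; apply: rank_leq_col.
case/rowV0Pn=> a /sub_kermxP aM a0; pose w := \sum_j a 0 j *: f j.
have w0 : w != 0.
  apply: contraNneq a0 => w0; apply/eqP/rowP=> j; rewrite mxE.
  by rewrite -(form_sum_on _ _ f_on) -/w w0 linear0l.
have [c _ cw] := normalize w0; exists (c *: w); split=> // [|i].
  by rewrite memvZ // memv_suml // => j _; rewrite memvZ.
have /rowP/(_ i) := aM; rewrite !mxE => aMi.
rewrite linearZl_LR /= linear_sumlz (_ : \sum_j _ = 0) ?mulr0 // -[RHS]aMi.
by apply: eq_bigr => j _; rewrite mxE linearZl_LR.
Qed.

(** The left-hand side is <P u, v> with P the orthogonal projection to W, so
u is an eigenvector of the compression of P to V; the matrix of this
compression in an orthonormal basis of V is M M^* with M the matrix of inner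
products. *)
Lemma projection_eigenvector V W n (f : 'I_n -> X) :
    (0 < \dim V)%N -> onb W f ->
  exists u lam, [/\ u \in V, form u u = 1 & forall v, v \in V ->
    \sum_j form u (f j) * form (f j) v = toK lam * form u v].
Proof.
move=> dimV f_onb; have [e e_onb] := onb_exists V; have [_ eV e_on] := e_onb.
pose M := \matrix_(i, j) form (e i) (f j).
have [lam [a [a0 aM]]] := gram_mx_eigenvector M dimV.
pose u := \sum_i a 0 i *: e i.
have u0 : u != 0.
  apply: contraNneq a0 => u0; apply/eqP/rowP=> j; rewrite mxE.
  by rewrite -(form_sum_on _ _ e_on) -/u u0 linear0l.
have uV : u \in V by rewrite memv_suml // => j _; rewrite memvZ.
have uP v : v \in V ->
    \sum_j form u (f j) * form (f j) v = toK lam * form u v.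
  move=> vV; pose x := \row_i form v (e i).
  have formx y : form y v = \sum_i form y (e i) * conj (x 0 i).
    rewrite (onb_form_r _ e_onb vV); apply: eq_bigr => i _.
    by rewrite mxE -form_conjC.
  have := congr1 (fun b : 'rV_(\dim V) => (b *m x^t conj) 0 0) aM.
  rewrite -scalemxAl mulmxA -!mulmxA mulmxA !mxE => aMx.
  rewrite formx -[RHS](_ : toK lam * (\sum_i a 0 i * conj (x 0 i)) = _);
    last first.
    congr (_ * _); apply: eq_bigr => i _; congr (_ * _).
    by rewrite (form_sum_on _ _ e_on).
  transitivity (\sum_j (a *m M) 0 j * (M^t conj *m x^t conj) j 0).
    apply: eq_bigr => j _; congr (_ * _).
      rewrite mxE linear_sumlz; apply: eq_bigr => i _.
      by rewrite mxE linearZl_LR.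
    rewrite formx mxE; apply: eq_bigr => i _; rewrite !mxE.
    by rewrite [form (f j) _]form_conjC.
  by rewrite aMx; congr (_ * _); apply: eq_bigr => i _; rewrite !mxE.
have [c _ cu] := normalize u0; exists (c *: u), lam; split=> // [|v vV].
  by rewrite memvZ.
under eq_bigr do rewrite linearZl_LR /= -mulrA.
by rewrite -mulr_sumr uP // linearZl_LR /= mulrCA.
Qed.

(** Take u an eigenvector of the compression to V of the projection to W,
with eigenvalue lam, and w its normalised projection, so that c = sqrt lam.
The last two clauses let the construction continue in the complements of u in
V and of w in W. When lam = 0 the projection of u vanishes and w can be any
unit vector of W orthogonal to the complement of u in V, which exists as dim
V <= dim W. *)
Lemma principal_pair V W : (0 < \dim V <= \dim W)%N ->
  exists u w (c : R),
    [/\ u \in V /\ form u u = 1, w \in W /\ form w w = 1,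
        0 <= c <= 1 /\ form u w = toK c,
        forall v, v \in V -> form v u = 0 -> form v w = 0 &
        forall x, x \in W -> form x w = 0 -> form x u = 0].
Proof.
move=> /andP[dimV leVW]; have [f f_onb] := onb_exists W.
have [u [lam [uV uu uP]]] := projection_eigenvector dimV f_onb.
have [_ fW _] := f_onb.
pose w := \sum_j form u (f j) *: f j.
have wW : w \in W by rewrite memv_suml // => j _; rewrite memvZ.
have wE x : form w x = \sum_j form u (f j) * form (f j) x.
  by rewrite linear_sumlz; apply: eq_bigr => j _; rewrite linearZl_LR.
have wx x : x \in W -> form w x = form u x.
  by move=> xW; rewrite wE (onb_form_r _ f_onb xW).
have wv v : v \in V -> form w v = toK lam * form u v.
  by move=> vV; rewrite wE uP.
have wu : form w u = toK lam by rewrite wv // uu mulr1.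
have uw : form u w = toK lam by rewrite form_conjC wu conj_toK.
have ww : form w w = toK lam by rewrite wx.
have lam_ge0 : 0 <= lam.
  have [r r0] := form_toK w; rewrite ww => /(fmorph_inj toK) ->; exact: r0.
(* By Pythagoras, 1 - lam is the squared distance from u to W. *)
have lam_le1 : lam <= 1.
  have [r r0] := form_toK (u - w); rewrite formBB uu uw wu ww subrK.
  rewrite -(rmorph1 toK) -rmorphB => /(fmorph_inj toK) E.
  by rewrite -subr_ge0 E.
have [lam0|lam0] := eqVneq lam 0.
  have w0 : w = 0 by apply/eqP; rewrite -form_eq0 ww lam0 rmorph0.
  have [g g_onb] := onb_exists (V :&: orthov form <[u]>).
  have [|x [xW xx xg]] := @unit_vector_orthogonal_to W _ g.
    by rewrite -(dim_orthov_line uV uu).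
  exists u, x, 0; split=> //.
  - by rewrite lexx ler01 -wx // w0 linear0l rmorph0.
  - move=> v vV vu; rewrite (onb_form _ g_onb) ?big1 // => [i _|].
      by rewrite (form_sym0 (xg i)) mulr0.
    by rewrite memv_cap vV mem_orthov1 /= vu eqxx.
  - by move=> y yW _; rewrite form_conjC -wx // w0 linear0l rmorph0.
pose c := Num.sqrt lam.
have cc : c * c = lam by rewrite -expr2 sqr_sqrtr.
have c_neq0 : c != 0 by apply: contraNneq lam0 => c0; rewrite -cc c0 mulr0.
exists u, (toK c^-1 *: w), c; split.
- by [].
- rewrite memvZ // linearZl_LR linearZr_LR /= ww conj_toK -!rmorphM -cc.
  by rewrite mulKf // mulVf // rmorph1.
- rewrite linearZr_LR /= uw conj_toK -rmorphM -cc mulKf // sqrtr_ge0.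
  split=> //=; rewrite -(@ler_pXn2r _ 2) ?nnegrE ?sqrtr_ge0 //.
  by rewrite sqr_sqrtr // expr1n.
- move=> v vV vu; rewrite linearZr_LR /= [form v w]form_conjC wv //.
  by rewrite (form_sym0 vu) mulr0 rmorph0 mulr0.
- move=> x xW /eqP; rewrite linearZr_LR /= conj_toK mulf_eq0 toK_eq0 invr_eq0.
  rewrite (negbTE c_neq0) => /eqP xw.
  by rewrite form_conjC -wx // form_sym0 // rmorph0.
Qed.

(** Principal bases with the cosines in any order: their product, which is
all that the Grassmann angle depends on, is insensitive to it. *)
Definition principal V W p q (e : 'I_p -> X) (f : 'I_q -> X) (c : 'I_p -> R) :=
  [/\ onb V e, onb W f, forall i, 0 <= c i <= 1 &
    forall i j, form (e i) (f j) = if i == j :> nat then toK (c i) else 0].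

Lemma principal_bases V W p q :
    \dim V = p -> \dim W = q -> (p <= q)%N ->
  exists (e : 'I_p -> X) (f : 'I_q -> X) (c : 'I_p -> R), principal V W e f c.
Proof.
elim: p q V W => [|p IHp] q V W dimV dimW le_pq.
  have [f f_onb] := onb_exists W; rewrite -dimW.
  exists (fun=> 0), f, (fun=> 0); split=> //; last by case.
    by split=> // -[].
  by move=> i; rewrite lexx ler01.
case: q => // q in dimW le_pq *.
have [|u [w [c0 [[uV uu] [wW ww] [c01 uw] vw xu]]]] := @principal_pair V W.
  by rewrite dimV dimW.
have := dim_orthov_line uV uu; rewrite dimV => -[dimV'].
have := dim_orthov_line wW ww; rewrite dimW => -[dimW'].
have [e [f [c [e_onb f_onb c_01 efc]]]] :=
  IHp q _ _ (esym dimV') (esym dimW') le_pq.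
exists (fun i => if unlift ord0 i is Some j then e j else u).
exists (fun i => if unlift ord0 i is Some j then f j else w).
exists (fun i => if unlift ord0 i is Some j then c j else c0).
split; try exact: onb_cons.
  by move=> i; case: unliftP.
have [[_ eV _] [_ fW _]] := (e_onb, f_onb).
move=> i j; case: unliftP => [i'|] ->; case: unliftP => [j'|] -> //=.
- have := eV i'; rewrite memv_cap mem_orthov1 => /andP[ev /eqP eu].
  exact: vw.
- have := fW j'; rewrite memv_cap mem_orthov1 => /andP[fw /eqP fw0].
  by rewrite form_sym0 // xu.
Qed.

Lemma orthonormal_tupleP n (t : n.-tuple X) :
  reflect (forall i j, form (tnth t i) (tnth t j) = (i == j)%:R)
          (orthonormal form t).
Proof.
have pairE (s : seq X) :
    pair_ortho_rec form s = pairwise (fun u v => form u v == 0) s.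
  by elim: s => //= u s ->; rewrite andbT.
rewrite /orthonormal pairE; apply: (iffP andP) =>
  [[unit_t /pairwiseP ortho_t] i j|on_t].
  have [->|neq_ij] := eqVneq i j.
    by have /allP/(_ _ (mem_tnth j t))/eqP := unit_t.
  have lt_ortho (k l : 'I_n) : (k < l)%N -> form (tnth t k) (tnth t l) = 0.
    move=> kl; apply/eqP; rewrite !(tnth_nth 0).
    by apply: ortho_t => //; rewrite inE size_tuple.
  have /orP[ij|ji] : (i < j)%N || (j < i)%N by rewrite -neq_ltn.
    exact: lt_ortho.
  exact/form_sym0/lt_ortho.
split; first by apply/allP=> _ /tnthP[i ->]; rewrite /= on_t eqxx.
apply/(pairwiseP 0) => i j; rewrite !inE size_tuple => ti tj ij.
have := on_t (Ordinal ti) (Ordinal tj); rewrite !(tnth_nth 0) /= => ->.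
by rewrite -val_eqE /= ltn_eqF.
Qed.

(** The bases of [principal_bases] come in no particular order, whereas
principal angles are nondecreasing: the permutation that sorts the angles is
applied to the basis of V and to the first dim V vectors of the basis of W. *)
Lemma exists_principal_angles V W : (\dim V <= \dim W)%N ->
  exists t, is_principal_angles toK form V W t.
Proof.
move=> leVW.
have [e [f [c [e_onb f_onb c01 ef]]]] :=
  principal_bases (erefl _) (erefl _) leVW.
pose t0 := [tuple acos (c i) | i < \dim V].
have [s ts] : exists s : 'S_(\dim V),
    sort <=%R t0 = [tuple tnth t0 (s i) | i < \dim V].
  by apply/tuple_permP; rewrite perm_sort.
have t_nth (i : 'I_(\dim V)) : (sort <=%R t0)`_i = acos (c (s i)).
  by rewrite ts nth_mktuple tnth_mktuple.
(* Basis vectors of W without a partner in V stay in place. *)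
pose r (j : 'I_(\dim W)) : 'I_(\dim W) :=
  if insub (val j) is Some i then widen_ord leVW (s i) else j.
have r_inj : injective r.
  move=> j k; rewrite /r.
  case: insubP => [i _ ij|]; case: insubP => [l _ lk|] //.
  - move=> /(congr1 val)/= /val_inj/perm_inj il.
    by apply: val_inj; rewrite -ij -lk il.
  - by rewrite -leqNgt /= => + /(congr1 val)/= E; rewrite -E leqNgt ltn_ord.
  - by rewrite -leqNgt /= => + /(congr1 val)/= E; rewrite E leqNgt ltn_ord.
have [[_ eV e_on] [_ fW f_on]] := (e_onb, f_onb).
have e'_onb : onb V (fun i => e (s i)).
  by split=> // i j; rewrite e_on (inj_eq perm_inj).
have f'_onb : onb W (fun j => f (r j)).
  by split=> // i j; rewrite f_on (inj_eq r_inj).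
exists (sort <=%R t0); split.
- by rewrite size_sort size_tuple (minn_idPl leVW).
- exact: sort_le_sorted.
- move=> x; rewrite mem_sort => /mapP[i _ ->].
  have ci := c01 i; rewrite acos_lepihalf // acos_ge0 //.
  by case/andP: ci => ci0 ->; rewrite (le_trans _ ci0) // oppr_le0 ler01.
exists (mktuple (fun i => e (s i))), (mktuple (fun j => f (r j))); split.
- by split; [exact: onb_basis | apply/orthonormal_tupleP=> i j;
    rewrite !tnth_mktuple; case: e'_onb].
- by split; [exact: onb_basis | apply/orthonormal_tupleP=> i j;
    rewrite !tnth_mktuple; case: f'_onb].
move=> i j; rewrite /inner !tnth_mktuple form_conjC ef t_nth /r.
rewrite acosK; last first.
  have /andP[c0 c1] := c01 (s i).
  by rewrite in_itv /= c1 (le_trans _ c0) // oppr_le0 ler01.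
case: insubP => [k _ kj|]; rewrite /=.
  rewrite -kj !val_eqE (inj_eq perm_inj).
  by case: eqP; rewrite ?conj_toK ?rmorph0.
rewrite -leqNgt => Vj.
have neq (k : 'I_(\dim V)) : (k == j :> nat) = false.
  by apply/negbTE; rewrite ltn_eqF // (leq_trans (ltn_ord k)).
by rewrite !neq rmorph0.
Qed.

Lemma principal_angles_bases V W : (\dim V <= \dim W)%N ->
  exists (e : 'I_(\dim V) -> X) (f : 'I_(\dim W) -> X) (c : 'I_(\dim V) -> R),
    principal V W e f c /\
    \prod_(x <- principal_angles toK form V W) cos x = \prod_i c i.
Proof.
move=> leVW.
have : is_principal_angles toK form V W (principal_angles toK form V W).
  have [t Ht] := exists_principal_angles leVW.
  exact: (@xgetI _ [::] _ t Ht).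
move: (principal_angles toK form V W) => t.
rewrite /is_principal_angles (minn_idPl leVW) => -[size_t _ t01].
move=> [e [f [[e_basis /orthonormal_tupleP e_on]
  [f_basis /orthonormal_tupleP f_on] ef]]].
exists (tnth e), (tnth f), (fun i => cos t`_i); split; last first.
  by rewrite (big_nth 0) big_mkord size_t.
split.
- by split=> // i; rewrite (basis_mem e_basis) // mem_tnth.
- by split=> // i; rewrite (basis_mem f_basis) // mem_tnth.
- move=> i; rewrite cos_le1 andbT cos_ge0_pihalf //.
  have /t01/andP[t0 t1] : t`_i \in t by rewrite mem_nth // size_t.
  by rewrite t1 andbT (le_trans _ t0) // oppr_le0 divr_ge0 ?pi_ge0.
move=> i j; rewrite form_conjC -/(inner form _ _) ef.
by case: eqP; rewrite ?conj_toK ?rmorph0.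
Qed.

(** * Gram matrices *)

Definition gram m n (e : 'I_m -> X) (f : 'I_n -> X) : 'M[R[i]]_(m, n) :=
  \matrix_(i, j) kap (form (e i) (f j)).

Lemma gram_conj m n (e : 'I_m -> X) (f : 'I_n -> X) : (gram e f)^t* = gram f e.
Proof. by apply/matrixP=> i j; rewrite !mxE -kap_conj -form_conjC. Qed.

Lemma gram_onb V n (e : 'I_n -> X) : onb V e -> gram e e = 1%:M.
Proof.
by case=> _ _ e_on; apply/matrixP=> i j; rewrite !mxE e_on rmorph_nat.
Qed.

Lemma gram_mul_l V m n k (e : 'I_m -> X) (f : 'I_n -> X) (g : 'I_k -> X) :
  onb V f -> (forall i, e i \in V) -> gram e f *m gram f g = gram e g.
Proof.
move=> f_onb eV; apply/matrixP=> i j.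
rewrite !mxE (onb_form _ f_onb (eV i)) rmorph_sum.
by apply: eq_bigr => l _; rewrite !mxE rmorphM.
Qed.

Lemma gram_mul_r V m n k (e : 'I_m -> X) (f : 'I_n -> X) (g : 'I_k -> X) :
  onb V f -> (forall j, g j \in V) -> gram e f *m gram f g = gram e g.
Proof.
move=> f_onb gV; apply/matrixP=> i j.
rewrite !mxE (onb_form_r _ f_onb (gV j)) rmorph_sum.
by apply: eq_bigr => l _; rewrite !mxE rmorphM.
Qed.

Section Principal.
Variables (V W : {vspace X}) (p q : nat) (le_pq : (p <= q)%N).
Variables (e : 'I_p -> X) (f : 'I_q -> X) (c : 'I_p -> R).
Hypothesis pr : principal V W e f c.

Lemma gram_principal :
  gram e f *m gram f e = diag_mx (\row_i (c i ^+ 2)%:C%C).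
Proof.
have [_ _ _ ef] := pr; apply/matrixP=> i k; rewrite !mxE.
rewrite (bigD1 (widen_ord le_pq i)) //= big1 => [|j ji].
  rewrite !mxE ef /= eqxx addr0 [form (f _) _]form_conjC ef /= val_eqE.
  have [->|ki] := eqVneq k i; last by rewrite !rmorph0 mulr0.
  rewrite mulr1n kap_conj kap_toK rmorphXn expr2; congr (_ * _).
  exact: conjc_real.
rewrite !mxE ef; have [ij|] := eqP; last by rewrite rmorph0 mul0r.
by case/eqP: ji; apply: val_inj.
Qed.

(** Changing the orthonormal bases multiplies the Gram matrix by unitary
matrices, which leaves this determinant unchanged. Hence the product of the
principal cosines depends on V and W only, and may be computed in any bases. *)
Lemma det_gram_principal (e' : 'I_p -> X) (f' : 'I_q -> X) :
    onb V e' -> onb W f' ->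
  \det (gram e' f' *m gram f' e') = ((\prod_i c i) ^+ 2)%:C%C.
Proof.
move=> e'_onb f'_onb; have [e_onb f_onb _ _] := pr.
have [[_ eV _] [_ fW _]] := (e_onb, f_onb).
have [[_ e'V _] [_ f'W _]] := (e'_onb, f'_onb).
have -> : gram e' f' *m gram f' e' =
    gram e' e *m (gram e f *m gram f e) *m gram e e'.
  rewrite !mulmxA (gram_mul_l _ e_onb) // -[in RHS]mulmxA.
  rewrite (gram_mul_r _ e_onb) //.
  by rewrite -[gram e' f](gram_mul_r _ f'_onb) // -mulmxA (gram_mul_l _ f_onb).
rewrite !det_mulmx mulrAC -det_mulmx (gram_mul_l _ e_onb) // (gram_onb e'_onb).
rewrite det1 mul1r gram_principal det_diag rmorphXn rmorph_prod -prodrXl.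
by apply: eq_bigr => i _; rewrite mxE rmorphXn.
Qed.

Lemma det_gram_widen :
  \det (gram e (fun i : 'I_p => f (widen_ord le_pq i))) = (\prod_i c i)%:C%C.
Proof.
have [_ _ _ ef] := pr.
have -> : gram e (fun i : 'I_p => f (widen_ord le_pq i)) =
    diag_mx (\row_i (c i)%:C%C).
  apply/matrixP=> i j; rewrite !mxE ef /=.
  by rewrite val_eqE; case: eqP => _; rewrite ?kap_toK ?rmorph0.
by rewrite det_diag rmorph_prod; apply: eq_bigr => i _; rewrite mxE.
Qed.

Lemma prod_principal_itv : 0 <= \prod_i c i <= 1.
Proof.
have [_ _ c01 _] := pr; rewrite prodr_ge0 => [|i _]; last by case/andP: (c01 i).
by rewrite prodr_ile1.
Qed.

End Principal.

(** All Pluecker vectors are taken in the coordinates of an orthonormal basis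
b of X; [x], [y] and [z] come from the basis e of U, from the p first vectors
of the basis f of V, and from the projections of the latter to W. *)
Lemma principal_triangle U V W p q r
    (e : 'I_p -> X) (f : 'I_q -> X) (a : 'I_p -> R)
    (e2 : 'I_q -> X) (f2 : 'I_r -> X) (d : 'I_q -> R)
    (e3 : 'I_p -> X) (f3 : 'I_r -> X) (g : 'I_p -> R) :
    (p <= q)%N -> (q <= r)%N ->
    principal U V e f a -> principal V W e2 f2 d -> principal U W e3 f3 g ->
  acos (\prod_i g i) <= acos (\prod_i a i) + acos (\prod_i d i).
Proof.
move=> le_pq le_qr prUV prVW prUW; have le_pr := leq_trans le_pq le_qr.
have [e_onb f_onb _ _] := prUV; have [e2_onb f2_onb d01 _] := prVW.
have [_ eU _] := e_onb; have [_ fV f_on] := f_onb.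
have [_ e2V _] := e2_onb; have [_ f2W _] := f2_onb.
have [b b_onb] := onb_exists fullv.
have gramb m n (h : 'I_m -> X) (k : 'I_n -> X) :
    gram h b *m gram b k = gram h k.
  by rewrite (gram_mul_l _ b_onb) // => i; rewrite memvf.
pose h i := f (widen_ord le_pq i).
have hV i : h i \in V by exact: fV.
have hh : gram h h = 1%:M.
  by apply/matrixP=> i j; rewrite !mxE f_on -(inj_eq val_inj) rmorph_nat.
pose sigma := \det (gram h f2 *m gram f2 h).
have sigma_ge : ((\prod_i d i) ^+ 2)%:C%C <= sigma.
  have -> : sigma = \det (gram h e2 *m diag_mx (\row_j (d j ^+ 2)%:C%C) *m
      (gram h e2)^t*).
    rewrite -(gram_principal le_qr prVW) gram_conj !mulmxA.
    rewrite (gram_mul_l _ e2_onb) //.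
    by rewrite -[in RHS]mulmxA (gram_mul_r _ e2_onb).
  rewrite rmorphXn rmorph_prod -prodrXl.
  have -> : \prod_i (d i)%:C%C ^+ 2 = \prod_i (d i ^+ 2)%:C%C.
    by apply: eq_bigr => i _; rewrite rmorphXn.
  apply: prod_le_det_compression => [|j].
    by apply/unitarymxP; rewrite gram_conj (gram_mul_l _ e2_onb).
  have /andP[d0 d1] := d01 j.
  by rewrite ler0c sqr_ge0 /= -[leRHS]/((1 : R)%:C%C) lecR expr_le1.
have [s0 s0_ge0 sigmaE] : exists2 s : R, 0 <= s & sigma = (s ^+ 2)%:C%C.
  have /ge0_real_complex[s s_ge0 ->] : 0 <= sigma.
    by rewrite /sigma -(gram_conj h f2) det_mulmx_conj_ge0.
  by exists (Num.sqrt s); rewrite ?sqrtr_ge0 ?sqr_sqrtr.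
pose x := plucker (gram e b); pose y := plucker (gram h b).
pose z := plucker (gram h f2 *m gram f2 b).
have z_conj : (gram h f2 *m gram f2 b)^t* = gram b f2 *m gram f2 h.
  by rewrite trmx_mul map_mxM !gram_conj.
have xx : dotmx x x = 1.
  by rewrite dotmx_plucker gram_conj gramb (gram_onb e_onb) det1.
have yy : dotmx y y = 1 by rewrite dotmx_plucker gram_conj gramb hh det1.
have xy : dotmx x y = (\prod_i a i)%:C%C.
  by rewrite dotmx_plucker gram_conj gramb (det_gram_widen le_pq prUV).
have yz : dotmx y z = (s0 ^+ 2)%:C%C.
  by rewrite dotmx_plucker z_conj mulmxA gramb -sigmaE.
have zz : dotmx z z = (s0 ^+ 2)%:C%C.
  rewrite dotmx_plucker z_conj mulmxA -[_ *m gram b f2]mulmxA gramb.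
  by rewrite (gram_onb f2_onb) mulmx1 -sigmaE.
have xz : `|dotmx x z| <= (\prod_i g i * s0)%:C%C.
  have g_ge0 : 0 <= \prod_i g i by case/andP: (prod_principal_itv prUW).
  rewrite -(@ler_pXn2r _ 2) ?nnegrE ?normr_ge0 ?ler0c ?mulr_ge0 //.
  rewrite dotmx_plucker z_conj mulmxA gramb -(gram_conj h f2).
  apply: le_trans (det_CauchySchwarz _ _) _; rewrite !gram_conj -/sigma sigmaE.
  rewrite (det_gram_principal le_pr prUW e_onb f2_onb).
  by rewrite -rmorphM -rmorphXn exprMn.
have s0_le1 : s0 <= 1.
  have := CauchySchwarz (@dotmx _ _) y z; rewrite /= yy yz zz mul1r => -[+ _].
  rewrite ger0_norm ?ler0c ?sqr_ge0 // -rmorphXn lecR => s0_sqr.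
  by rewrite -(@expr_le1 _ 2) //; move: (s0 ^+ 2) s0_sqr => t; nra.
(* The projection to W shrinks y no more than it shrinks a unit volume of V. *)
have d_s0 : \prod_i d i <= s0.
  have d_ge0 : 0 <= \prod_i d i by case/andP: (prod_principal_itv prVW).
  by move: sigma_ge; rewrite sigmaE lecR ler_pXn2r.
have s01 : 0 <= s0 <= 1 by rewrite s0_ge0.
have a01 := prod_principal_itv prUV; have g01 := prod_principal_itv prUW.
have d01' := prod_principal_itv prVW.
apply: le_trans (acos_triangle a01 s01 g01 _) _.
  by apply: dot_triangle xx yy xy yz zz xz s0_ge0 _; case/andP: g01.
by rewrite lerD2l ler_acos //; lra.
Qed.

(** * The asymmetric metric *)

Local Notation angle := (grassmann_angle toK form).

Lemma angle_ge0 V W : 0 <= angle V W.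
Proof.
rewrite /grassmann_angle; have pi2 : 0 <= pi / 2 :> R by have := pi_ge0 R; lra.
case: eqP => // _; case: eqP => // _; case: leqP => // leVW.
have [e [f [c [pr ->]]]] := principal_angles_bases leVW.
by have p01 := prod_principal_itv pr; apply: acos_ge0; lra.
Qed.

Lemma angle_le_pihalf V W : angle V W <= pi / 2.
Proof.
rewrite /grassmann_angle; have pi2 : 0 <= pi / 2 :> R by have := pi_ge0 R; lra.
case: eqP => // _; case: eqP => // _; case: leqP => // leVW.
have [e [f [c [pr ->]]]] := principal_angles_bases leVW.
exact/acos_lepihalf/(prod_principal_itv pr).
Qed.

(** If the angle is 0, all principal cosines are 1, so that |e_i - f_i|^2 = 0
and V lies in W. Conversely, if V lies in W, expanding e_i in the basis f
shows that 1 = |e_i|^2 = c_i^2. *)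
Lemma angle_eq0 V W : (angle V W = 0) <-> (V <= W)%VS.
Proof.
have pi2 : pi / 2 <> 0 :> R by have := pi_gt0 R; lra.
rewrite /grassmann_angle; case: eqP => [-> | /eqP V0]; first by rewrite sub0v.
case: eqP => [-> | /eqP W0]; first by rewrite subv0 (negbTE V0).
case: leqP => [leVW | ltWV]; last first.
  by split=> // /dimvS; rewrite leqNgt ltWV.
have [e [f [c [pr ->]]]] := principal_angles_bases leVW.
have [e_onb f_onb c01 ef] := pr.
have [[_ eV e_on] [_ fW f_on]] := (e_onb, f_onb).
split=> [acos0|sVW].
  have prod1 : \prod_i c i = 1.
    rewrite -[LHS]acosK ?acos0 ?cos0 // in_itv /=.
    by have := prod_principal_itv pr; lra.
  have c1 i : c i = 1.
    apply/eqP; rewrite eq_le; case/andP: (c01 i) => c0 -> /=.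
    by rewrite -prod1 (bigD1 i) //= ler_piMr // prodr_ile1.
  have e_f i : e i = f (widen_ord leVW i).
    apply/eqP; rewrite -subr_eq0 -form_eq0 formBB e_on f_on.
    rewrite [form (f _) _]form_conjC ef /= !eqxx c1 rmorph1 rmorph1.
    by rewrite subrr sub0r addNr.
  apply/subvP=> v vV; rewrite (onb_expand e_onb vV).
  by apply: memv_suml => i _; rewrite memvZ // e_f.
rewrite big1 ?acos1 // => i _.
have /subvP/(_ _ (eV i)) eW := sVW.
have := onb_form (e i) f_onb eW.
rewrite (bigD1 (widen_ord leVW i)) //= big1 => [|j ji].
  rewrite e_on eqxx addr0 [form (f _) _]form_conjC ef /= eqxx conj_toK.
  rewrite -rmorphM -[true%:R](rmorph1 toK) => /(fmorph_inj toK)/esym/eqP.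
  rewrite -expr2 sqrf_eq1 => /orP[/eqP //|/eqP cN1].
  by have := c01 i; rewrite cN1; lra.
rewrite ef; have [ij|] := eqP; last by rewrite mul0r.
by case/eqP: ji; apply: val_inj.
Qed.

Lemma angle_triangle U V W : angle U W <= angle U V + angle V W.
Proof.
have [pihalf_le|] := boolP ((angle U V == pi / 2) || (angle V W == pi / 2)).
  apply: le_trans (angle_le_pihalf U W) _.
  case/orP: pihalf_le => /eqP ->; first by rewrite lerDl angle_ge0.
  by rewrite lerDr angle_ge0.
rewrite negb_or => /andP[].
have [-> | U0] := eqVneq U 0%VS.
  by rewrite {3}/grassmann_angle eqxx addr_ge0 ?angle_ge0.
rewrite {1}/grassmann_angle (negbTE U0).
have [-> | V0] := eqVneq V 0%VS; first by rewrite eqxx.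
case: leqP => [leUV _|]; last by rewrite eqxx.
rewrite {1}/grassmann_angle (negbTE V0).
have [-> | W0] := eqVneq W 0%VS; first by rewrite eqxx.
case: leqP => [leVW _|]; last by rewrite eqxx.
rewrite /grassmann_angle (negbTE U0) (negbTE V0) (negbTE W0) leUV leVW.
rewrite (leq_trans leUV leVW).
have [e [f [a [prUV ->]]]] := principal_angles_bases leUV.
have [e2 [f2 [d [prVW ->]]]] := principal_angles_bases leVW.
have [e3 [f3 [g [prUW ->]]]] := principal_angles_bases (leq_trans leUV leVW).
exact: principal_triangle prUV prVW prUW.
Qed.

Theorem grassmann_angle_asymmetric_metric :
  @asymmetric_metric R {vspace X} angle.
Proof.
split.
- by constructor; exact: 0%VS.
- exact: angle_ge0.
- move=> V W; rewrite !angle_eq0; split=> [[VW WV]|->]; last by [].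
  by apply/eqP; rewrite eqEsubv VW WV.
- move=> U V W; exact: angle_triangle.
Qed.

End InnerProductSpace.

Theorem theorem4p12 (R : realType) :
  (forall (X : vectType R) (ip : {dot X for (@idfun R)}),
     @asymmetric_metric R {vspace X}
       (@grassmann_angle R R (@idfun R) (@idfun R) X ip)) /\
  (forall (X : vectType R[i]) (ip : {dot X for (@Num.conj R[i])}),
     @asymmetric_metric R {vspace X}
       (@grassmann_angle R R[i] (real_complex R) (@Num.conj R[i]) X ip)).
Proof.
split=> X ip.
  apply: (@grassmann_angle_asymmetric_metric R R idfun idfun (real_complex R)).
  - by [].
  - by move=> x; apply/esym/conjc_real.
  - by move=> x; rewrite ler0c.
by apply: (@grassmann_angle_asymmetric_metric R R[i] (real_complex R) Num.conj
  idfun).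
Qed.
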